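(* Let $(A,\overline{()},\oplus,\cdot,1)$ be an IMM* algebra. The following two statements are equivalent. (i) For each $a,b,c\in A$, the equation $\overline{1}\oplus x=(\overline{b}\cdot a)\oplus(b\cdot c)$ has a solution $x$ in $A$. (ii) There is a unique mobi algebra $(A,p,\overline{1},\overline{1}\oplus 1,1)$ (that is, a unique ternary operation $p$ on $A$ making this system, with constants $0:=\overline1$, $\frac12:=\overline1\oplus1$ and $1$, a mobi algebra) such that $\overline{1}\oplus p(a,b,c)=(\overline{b}\cdot a)\oplus(b\cdot c)$ for all $a,b,c\in A$.
   Context: An IMM* algebra is a system $(C,\overline{()},\oplus,\cdot,1)$, where $C$ is a set, $\overline{()}$ is a unary operation, $\oplus$ and $\cdot$ are binary operations on $C$ and $1\in C$, such that for all elements of $C$: (C1) $a\oplus a=a$; (C2) $a\oplus b=b\oplus a$; (C3) $a\oplus b=a'\oplus b\implies a=a'$; (C4) $(a\oplus b)\oplus(c\oplus d)=(a\oplus c)\oplus(b\oplus d)$; (C5) $a\cdot(b\cdot c)=(a\cdot b)\cdot c$; (C6) $a\cdot 1=a=1\cdot a$; (C7) $a\cdot(b\oplus c)=(a\cdot b)\oplus(a\cdot c)$ and $(a\oplus b)\cdot c=(a\cdot c)\oplus(b\cdot c)$; (C8) $a\cdot\overline{1}=\overline{1}=\overline{1}\cdot a$; (C9) $\overline{a}\oplus a=\overline{1}\oplus 1$. A mobi algebra is a system $(A,p,0,\frac12,1)$, where $A$ is a set, $p:A^3\to A$ is a ternary operation and $0,\frac12,1$ are elements of $A$ ($\frac12$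 is only a symbol for a distinguished element), such that for all elements of $A$: (A1) $p(1,\frac12,0)=\frac12$; (A2) $p(0,a,1)=a$; (A3) $p(a,b,a)=a$; (A4) $p(a,0,b)=a$; (A5) $p(a,1,b)=b$; (A6) $p(a,\frac12,b)=p(a',\frac12,b)\implies a=a'$; (A7) $p(a,p(c_1,c_2,c_3),b)=p(p(a,c_1,b),c_2,p(a,c_3,b))$; (A8) $p(p(a_1,c,b_1),\frac12,p(a_2,c,b_2))=p(p(a_1,\frac12,a_2),c,p(b_1,\frac12,b_2))$. *)

(* Defs.v *)
Section IMMStar.

Variables (C : Type) (bar : C -> C) (oplus mul : C -> C -> C) (one : C).

Local Infix "⊕" := oplus (at level 50, left associativity).
Local Infix "·" := mul (at level 40, left associativity).

Record IMM_star_algebra : Prop := {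
  imm_idem : forall a, a ⊕ a = a;
  imm_comm : forall a b, a ⊕ b = b ⊕ a;
  imm_cancel : forall a a' b, a ⊕ b = a' ⊕ b -> a = a';
  imm_medial : forall a b c d, (a ⊕ b) ⊕ (c ⊕ d) = (a ⊕ c) ⊕ (b ⊕ d);
  imm_mul_assoc : forall a b c, a · (b · c) = (a · b) · c;
  imm_mul_one_r : forall a, a · one = a;
  imm_mul_one_l : forall a, one · a = a;
  imm_distr_l : forall a b c, a · (b ⊕ c) = (a · b) ⊕ (a · c);
  imm_distr_r : forall a b c, (a ⊕ b) · c = (a · c) ⊕ (b · c);
  imm_mul_bar_one_r : forall a, a · bar one = bar one;
  imm_mul_bar_one_l : forall a, bar one · a = bar one;
  imm_bar : forall a, bar a ⊕ a = bar one ⊕ one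
}.

End IMMStar.

Record mobi_algebra (A : Type) (p : A -> A -> A -> A) (zero half one : A) :
    Prop := {
  mobi_half : p one half zero = half;
  mobi_zero_one : forall a, p zero a one = a;
  mobi_idem : forall a b, p a b a = a;
  mobi_zero : forall a b, p a zero b = a;
  mobi_one : forall a b, p a one b = b;
  mobi_cancel : forall a a' b, p a half b = p a' half b -> a = a';
  mobi_assoc : forall a b c1 c2 c3,
    p a (p c1 c2 c3) b = p (p a c1 b) c2 (p a c3 b);
  mobi_medial : forall a1 b1 a2 b2 c,
    p (p a1 c b1) half (p a2 c b2) = p (p a1 half a2) c (p b1 half b2)
}.

(* Main.v *)
(** Write [h := 0 ⊕ 1] with [0 := bar 1]. By distributivity [0 ⊕ a = h · a = a · h], so [h] is central and, by cancellation, multiplication by [h] is injective. The equation defining [p] becomes [h · p a b c = (bar b · a) ⊕ (b · c)]; it has at most one solution, [p a h b = a ⊕ b], and each mobi axiom follows by multiplying both sides by [h] (or by [h · h] for (A7)) and using the medial law. *)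

Require Import Defs.
From Stdlib Require Import FunctionalExtensionality IndefiniteDescription.

Section IMMStarTheory.

Variables (A : Type) (bar : A -> A) (oplus mul : A -> A -> A) (one : A).
Hypothesis HA : IMM_star_algebra A bar oplus mul one.

Local Infix "⊕" := oplus (at level 50, left associativity).
Local Infix "·" := mul (at level 40, left associativity).
Local Notation zero := (bar one).
Local Notation half := (bar one ⊕ one).

Lemma oplus_cancel_l a b b' : a ⊕ b = a ⊕ b' -> b = b'.
Proof.
  rewrite (imm_comm _ _ _ _ _ HA a b), (imm_comm _ _ _ _ _ HA a b').
  apply (imm_cancel _ _ _ _ _ HA).
Qed.

Lemma half_mul a : half · a = zero ⊕ a.
Proof.
  now rewrite (imm_distr_r _ _ _ _ _ HA), (imm_mul_bar_one_l _ _ _ _ _ HA),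
    (imm_mul_one_l _ _ _ _ _ HA).
Qed.

Lemma mul_half a : a · half = zero ⊕ a.
Proof.
  now rewrite (imm_distr_l _ _ _ _ _ HA), (imm_mul_bar_one_r _ _ _ _ _ HA),
    (imm_mul_one_r _ _ _ _ _ HA).
Qed.

Lemma half_comm a : half · a = a · half.
Proof. now rewrite half_mul, mul_half. Qed.

Lemma half_mul_inj a b : half · a = half · b -> a = b.
Proof. rewrite !half_mul; apply oplus_cancel_l. Qed.

Lemma half_mul_swap a b : half · (a · b) = a · (half · b).
Proof. now rewrite !(imm_mul_assoc _ _ _ _ _ HA), half_comm. Qed.

Lemma bar_zero : bar zero = one.
Proof.
  apply (imm_cancel _ _ _ _ _ HA _ _ zero).
  now rewrite (imm_bar _ _ _ _ _ HA), (imm_comm _ _ _ _ _ HA one).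
Qed.

(** Cancellation makes [bar x] the only element whose sum with [x] is [half], and idempotence gives
    [half ⊕ half = half]. This fixed point is what turns [p a half b] into [a ⊕ b]. *)
Lemma bar_half : bar half = half.
Proof.
  apply (imm_cancel _ _ _ _ _ HA _ _ half).
  now rewrite (imm_bar _ _ _ _ _ HA), (imm_idem _ _ _ _ _ HA half).
Qed.

Section SolutionOperation.

Variable p : A -> A -> A -> A.
Hypothesis Hp : forall a b c, zero ⊕ p a b c = (bar b · a) ⊕ (b · c).

Lemma half_mul_sol a b c : half · p a b c = (bar b · a) ⊕ (b · c).
Proof. now rewrite half_mul. Qed.

Lemma sol_half a b : p a half b = a ⊕ b.
Proof.
  apply half_mul_inj.
  now rewrite half_mul_sol, bar_half, (imm_distr_l _ _ _ _ _ HA).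
Qed.

(** No axiom distributes [bar] over [⊕] or [·], so [bar (p a b c)] is reached through its
    characterization by [bar x ⊕ x = half]. It is needed for (A7), where [p] occurs under [bar]. *)
Lemma half_mul_bar_sol a b c :
  half · bar (p a b c) = (bar b · bar a) ⊕ (b · bar c).
Proof.
  apply (imm_cancel _ _ _ _ _ HA _ _ (half · p a b c)).
  (* Both sides become [half · half]; on the right, the medial law pairs [bar a] with [a] and
     [bar c] with [c], giving [(bar b ⊕ b) · half]. *)
  rewrite <- (imm_distr_l _ _ _ _ _ HA), (imm_bar _ _ _ _ _ HA (p a b c)),
    half_mul_sol, (imm_medial _ _ _ _ _ HA (bar b · bar a)),
    <- !(imm_distr_l _ _ _ _ _ HA _ (bar _)).
  now rewrite (imm_bar _ _ _ _ _ HA a), (imm_bar _ _ _ _ _ HA c),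
    <- (imm_distr_r _ _ _ _ _ HA (bar b)), (imm_bar _ _ _ _ _ HA b).
Qed.

Lemma sol_assoc a b c1 c2 c3 :
  p a (p c1 c2 c3) b = p (p a c1 b) c2 (p a c3 b).
Proof.
  (* One factor [half] opens the outer [p], the other the inner ones. *)
  apply half_mul_inj, half_mul_inj.
  rewrite (half_mul_sol a), (half_mul_sol (p a c1 b)).
  rewrite 2!(imm_distr_l _ _ _ _ _ HA half).
  rewrite (half_mul_swap (bar c2)), (half_mul_swap c2), !half_mul_sol.
  rewrite (imm_mul_assoc _ _ _ _ _ HA half), half_mul_bar_sol.
  rewrite (imm_mul_assoc _ _ _ _ _ HA half), half_mul_sol.
  rewrite !(imm_distr_l _ _ _ _ _ HA), !(imm_distr_r _ _ _ _ _ HA),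
    !(imm_mul_assoc _ _ _ _ _ HA).
  (* Both sides now sum the same four products, with the middle two exchanged. *)
  apply (imm_medial _ _ _ _ _ HA).
Qed.

Lemma sol_mobi_algebra : mobi_algebra A p zero half one.
Proof.
  constructor; intros.
  - now rewrite sol_half, (imm_comm _ _ _ _ _ HA).
  - apply (oplus_cancel_l zero).
    now rewrite Hp, (imm_mul_bar_one_r _ _ _ _ _ HA), (imm_mul_one_r _ _ _ _ _ HA).
  - apply half_mul_inj.
    now rewrite half_mul_sol, <- (imm_distr_r _ _ _ _ _ HA), (imm_bar _ _ _ _ _ HA b).
  - apply (oplus_cancel_l zero).
    now rewrite Hp, bar_zero, (imm_mul_bar_one_l _ _ _ _ _ HA),
      (imm_mul_one_l _ _ _ _ _ HA), (imm_comm _ _ _ _ _ HA).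
  - apply (oplus_cancel_l zero).
    now rewrite Hp, (imm_mul_bar_one_l _ _ _ _ _ HA), (imm_mul_one_l _ _ _ _ _ HA).
  - apply (imm_cancel _ _ _ _ _ HA _ _ b).
    now rewrite !sol_half in H.
  - apply sol_assoc.
  (* With [p _ half _] read as [⊕], a single layer of [p] remains on each side, so one factor [half]
     suffices. *)
  - rewrite !sol_half.
    apply half_mul_inj.
    rewrite half_mul_sol, !(imm_distr_l _ _ _ _ _ HA), !half_mul_sol.
    apply (imm_medial _ _ _ _ _ HA).
Qed.

End SolutionOperation.

End IMMStarTheory.

Theorem theorem6p2 (A : Type) (bar : A -> A) (oplus mul : A -> A -> A) (one : A)
    (HA : IMM_star_algebra A bar oplus mul one) :
  (forall a b c : A, exists x : A,
     oplus (bar one) x = oplus (mul (bar b) a) (mul b c))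
  <->
  (exists! p : A -> A -> A -> A,
     mobi_algebra A p (bar one) (oplus (bar one) one) one /\
     (forall a b c : A,
        oplus (bar one) (p a b c) = oplus (mul (bar b) a) (mul b c))).
Proof.
  split.
  - intros H.
    (* The solutions exist only in [Prop]; description gathers them into a function. *)
    pose (s := fun a b c => constructive_indefinite_description _ (H a b c)).
    pose (p := fun a b c => proj1_sig (s a b c)).
    assert (Hp : forall a b c,
        oplus (bar one) (p a b c) = oplus (mul (bar b) a) (mul b c))
      by (intros a b c; exact (proj2_sig (s a b c))).
    exists p; split.
    + split; [exact (sol_mobi_algebra _ _ _ _ _ HA p Hp) | exact Hp].
    + intros q [_ Hq].
      (* [p] and [q] solve the same equation pointwise, and its solution is unique by
         cancellation. *)
      extensionality a; extensionality b; extensionality c.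
      apply (oplus_cancel_l _ _ _ _ _ HA (bar one)).
      now rewrite Hp, Hq.
  - intros [p [[_ Hp] _]] a b c.
    exists (p a b c); apply Hp.
Qed.
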